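(* Let $p$ be a prime and $b\in\mathbb{F}_p^n$ with $b\neq\mathbf 0$. Then $R^{\mathrm{pub}}_{1/20}(\textsc{SolveLinearSystem}_b)=\Omega(n^2\log p)$.
   Context: $\textsc{SolveLinearSystem}_b$: Alice holds $x\in M_n(\mathbb{F}_p)$, Bob holds $y\in M_n(\mathbb{F}_p)$, with the promise that $x+y$ is invertible over $\mathbb{F}_p$; letting $t\in\mathbb{F}_p^n$ be the unique solution of $(x+y)t=b$, they must determine whether the first coordinate of $t$ is zero. $R^{\mathrm{pub}}_\delta$ is the $\delta$-error public-coin randomized two-player communication complexity (correct with probability $\ge1-\delta$ on every promise input; cost = worst-case bits communicated). *)

(* Defs.v *)
From HB Require Import structures.
From mathcomp Require Import all_boot all_order all_algebra.
From mathcomp Require Import all_classical all_reals all_analysis.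
Set Implicit Arguments.
Unset Strict Implicit.
Unset Printing Implicit Defensive.
Import Order.TTheory GRing.Theory Num.Theory.

Local Open Scope ring_scope.

(* At an inner node the owner of the node sends one bit, computed from her own
   input; the bit selects the subtree ([true]: first, [false]: second).  The
   output is read off the leaf, hence is a function of the transcript. *)
Inductive protocol (X Y Z : Type) : Type :=
| Output of Z
| AliceSends of (X -> bool) & protocol X Y Z & protocol X Y Z
| BobSends of (Y -> bool) & protocol X Y Z & protocol X Y Z.

Fixpoint run (X Y Z : Type) (pi : protocol X Y Z) (x : X) (y : Y) : Z :=
  match pi with
  | Output z => z
  | AliceSends a pi1 pi0 => if a x then run pi1 x y else run pi0 x y
  | BobSends a pi1 pi0 => if a y then run pi1 x y else run pi0 x y
  end.

Fixpoint bits (X Y Z : Type) (pi : protocol X Y Z) (x : X) (y : Y) : nat :=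
  match pi with
  | Output _ => 0%N
  | AliceSends a pi1 pi0 => (if a x then bits pi1 x y else bits pi0 x y).+1
  | BobSends a pi1 pi0 => (if a y then bits pi1 x y else bits pi0 x y).+1
  end.

(* A finitely supported distribution on deterministic protocols.  Finite
   support loses nothing: on finite input types only finitely many protocols
   have depth at most a given bound. *)
Record public_coin_protocol (R : realType) (X Y Z : Type) := PublicCoin {
  coins : finType;
  coin_prob : coins -> R;
  coin_prob_ge0 : forall w, 0 <= coin_prob w;
  coin_prob_sum1 : \sum_w coin_prob w = 1;
  protocol_of_coins : coins -> protocol X Y Z
}.
Arguments coin_prob {R X Y Z} _ _.
Arguments protocol_of_coins {R X Y Z} _ _.

Definition worst_case_cost (R : realType) (X Y : finType) (Z : Type)
    (P : public_coin_protocol R X Y Z) : nat :=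
  \max_(w : coins P) \max_(x : X) \max_(y : Y)
    bits (protocol_of_coins P w) x y.

(* Values of [answer] outside [promise] are irrelevant. *)
Record promise_problem (X Y Z : Type) := PromiseProblem {
  promise : X -> Y -> bool;
  answer : X -> Y -> Z
}.

Definition success_prob (R : realType) (X Y : Type) (Z : eqType)
    (f : promise_problem X Y Z) (P : public_coin_protocol R X Y Z)
    (x : X) (y : Y) : R :=
  \sum_(w | run (protocol_of_coins P w) x y == answer f x y) coin_prob P w.

Definition solves (R : realType) (X Y : Type) (Z : eqType) (delta : R)
    (f : promise_problem X Y Z) (P : public_coin_protocol R X Y Z) : Prop :=
  forall x y, promise f x y -> 1 - delta <= success_prob f P x y.

Definition Rpub (R : realType) (X Y : finType) (Z : eqType) (delta : R)
    (f : promise_problem X Y Z) : \bar R :=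
  ereal_inf [set k | exists2 P : public_coin_protocol R X Y Z,
    solves delta f P & k = ((worst_case_cost P)%:R)%:E]%classic.

(* On the promise there is exactly one [t] with [(x + y) *m t = b], so the
   existential speaks of that [t].  The dimension is [n.+1] so that there is a
   first coordinate. *)
Definition solve_linear_system (p n : nat) (b : 'cV['F_p]_n.+1) :
    promise_problem 'M['F_p]_n.+1 'M['F_p]_n.+1 bool :=
  {| promise := fun x y => (x + y) \in unitmx;
     answer := fun x y =>
       [exists t : 'cV['F_p]_n.+1, ((x + y) *m t == b) && (t ord0 ord0 == 0)] |}.

(* Main.v *)
Require Import Defs.
From mathcomp Require Import all_boot all_order all_algebra all_field.
From mathcomp Require Import zify ring lra.
From mathcomp Require Import all_classical all_reals all_analysis.
Set Implicit Arguments.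
Unset Strict Implicit.
Unset Printing Implicit Defensive.
Import Order.TTheory GRing.Theory Num.Theory.
Local Open Scope ring_scope.

(* Let f be the function of the corank k of an l x l matrix over F_p given by
   f = (1 - p)(1 - p^2)...(1 - p^k).  Its Fourier transform is bounded by
   p^(l(l+1)/2), so that f(x + y) has sum at most p^(l^2 + l(l+1)/2) over every
   combinatorial rectangle, whereas the invertible matrices alone contribute at
   least p^(2 l^2)/4 to the sum of f(x + y) over all x, y.

   A protocol for the linear system is turned into one for z = x + y of size
   l ~ n/4 by embedding z in a random larger matrix that has a known solution t.
   If z is invertible the embedding satisfies the promise and the output has a
   large bias towards the sign attached to t_1.  If z has corank k, the embedding
   has many solutions; with the sign of t_1 weighted so as to have mean zero over
   F_p, the bias cancels up to a factor p^(1 - 4k).  Since the matrices of corank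
   k have total |f|-mass at most p^(l^2), the invertible ones dominate, and a
   protocol of cost c satisfies p^(l^2) <= 12 * 2^c * p^(1 + l(l+1)/2). *)

(** * Counting matrices by corank *)

(** For a prime power [q], the order of GL_k over the field of [q] elements without its factor
    [q ^ 'C(k, 2)]. *)
Definition qfact (q k : nat) : nat := \prod_(i < k) (q ^ i.+1 - 1).

Lemma card_unitmx (F : finFieldType) (n : nat) :
  #|[pred g : 'M[F]_n | g \in unitmx]| = (#|F| ^ 'C(n, 2) * qfact #|F| n)%N.
Proof.
case: n => [|n].
  rewrite /qfact big_ord0 muln1 expn0.
  rewrite (eq_card (B := [pred g : 'M[F]_0 | true])); last first.
    by move=> g; rewrite !inE unitmxE det_mx00 unitr1.
  by rewrite (eq_card (B := 'M[F]_0)) // card_mx.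
have := card_GL F (ltn0Sn n).
rewrite /qfact big_add1 big_mkord /= => <-.
by rewrite cardsT card_sub; apply: eq_card => g; rewrite !inE.
Qed.

Lemma qfact_lower_bound (q k : nat) :
  (1 < q)%N -> (q ^ 'C(k.+1, 2) <= 4 * qfact q k)%N.
Proof.
move=> q_gt1.
(* The lower bound 1/4 for the product of the 1 - q^-i is not inductive; 1/4 + 2^-(k+1) is, starting
   from k = 1. *)
suff H : (0 < k -> q ^ 'C(k.+1, 2) * (2 ^ k + 2) <= 4 * 2 ^ k * qfact q k)%N.
  case: k H => [|k] H; first by rewrite /qfact big_ord0.
  rewrite -(leq_pmul2r (m := 2 ^ k.+1)) ?expn_gt0 // mulnAC.
  by apply: leq_trans (H isT); rewrite leq_pmul2l ?expn_gt0 ?leq_addr //; lia.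
elim: k => // -[_ _|k /(_ isT) IH _].
  rewrite /qfact big_ord1 /= binn; nia.
rewrite /qfact big_ord_recr /= -/(qfact q k.+1).
rewrite [in X in (X <= _)%N]binS bin1 expnD.
set a := (q ^ 'C(k.+2, 2))%N in IH *; set c := qfact q k.+1 in IH *.
set y := (q ^ k.+2)%N; set t := (2 ^ k.+1)%N in IH *.
have yt : (2 * t <= y)%N by rewrite /t /y -expnS leq_exp2r.
have t2 : (2 <= t)%N by rewrite /t expnS leq_pmulr ?expn_gt0.
rewrite (_ : 2 ^ k.+2 = 2 * t)%N; last by rewrite /t expnS.
have : (a * (t + 2) * (2 * (y - 1)) <=
  4 * t * c * (2 * (y - 1)))%N by rewrite leq_mul2r IH orbT.
rewrite (_ : 4 * (2 * t) * (c * (y - 1)) = 4 * t * c * (2 * (y - 1)))%N; last by ring.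
clearbody y; apply: leq_trans; rewrite -!mulnA leq_mul2l; apply/orP; right.
clear IH; clearbody t; move: yt t2 => /subnK <- t2; move: (y - _)%N => d.
rewrite (_ : d + 2 * t - 1 = d + t + (t - 1))%N; last by lia.
nia.
Qed.

Lemma unitmx_lower_bound (F : finFieldType) (n : nat) :
  (#|F| ^ (n * n) <= 4 * #|[pred g : 'M[F]_n | g \in unitmx]|)%N.
Proof.
rewrite card_unitmx mulnCA.
apply: (@leq_trans (#|F| ^ 'C(n, 2) * #|F| ^ 'C(n.+1, 2)))%N.
  by rewrite -expnD leq_exp2l ?finNzRing_gt1 // binS bin1 addnA addnn -mul2n
    -!(mul_bin_diag _ 1) bin1; case: n => //= n; lia.
by rewrite leq_mul2l qfact_lower_bound ?finNzRing_gt1 ?orbT.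
Qed.

Section Submx.
Variable F : finFieldType.

Lemma sub_row_base_onto (m n a : nat) (A : 'M[F]_(m, n)) (M : 'M[F]_(a, n)) :
  (M <= A)%MS -> exists y : 'M[F]_(a, \rank A), M = y *m row_base A.
Proof. by rewrite -(eq_row_base A) => /submxP. Qed.

(** Coefficients with respect to [row_base A] parametrise these matrices without repetition. *)
Lemma sum_submx (T : nmodType) (m n a : nat) (A : 'M[F]_(m, n)) (G : 'M[F]_(a, n) -> T) :
  \sum_(M | (M <= A)%MS) G M = \sum_(y : 'M[F]_(a, \rank A)) G (y *m row_base A).
Proof.
have inj : injective (mulmx^~ (row_base A) : 'M[F]_(a, \rank A) -> 'M[F]_(a, n)).
  exact/row_free_inj/row_base_free.
rewrite (reindex_omap (I := 'M[F]_(a, n)) (mulmx^~ (row_base A) : 'M[F]_(a, \rank A) -> _)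
  (fun M => [pick y | M == y *m row_base A])); last first.
  move=> M /sub_row_base_onto[y ->]; case: pickP => [z /eqP -> //|/(_ y)].
  by rewrite eqxx.
apply: eq_bigl => y; rewrite -[in X in X && _](eq_row_base A) submxMl /=.
case: pickP => [z /eqP/inj-> |/(_ y)]; rewrite ?eqxx //.
Qed.

Lemma card_submx (m n a : nat) (A : 'M[F]_(m, n)) :
  #|[pred M : 'M[F]_(a, n) | (M <= A)%MS]| = (#|F| ^ (a * \rank A))%N.
Proof.
rewrite -sum1_card sum_submx sum1_card.
by rewrite card_mx.
Qed.

Lemma rank_col_mx_row (m n : nat) (zeta : 'rV[F]_n) (z : 'M[F]_(m, n)) :
  \rank (col_mx zeta z) = (\rank z + ~~ (zeta <= z)%MS)%N.
Proof.
rewrite -addsmxE addnC; have [sub|nsub] := boolP (zeta <= z)%MS.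
  by rewrite (addsmx_idPr sub) add0n.
apply/eqP; rewrite eqn_leq; apply/andP; split.
  by apply: leq_trans (mxrank_adds_leqif _ _) _; rewrite leq_add2r rank_leq_row.
rewrite add1n; apply: rank_ltmx; rewrite ltmxE addsmxSr /=.
by apply: contra nsub => /(submx_trans (addsmxSl _ _)).
Qed.

(* Double counting of the pairs [(U, z)] with [U] row-free and [U *m z = 0]. *)
Lemma card_corank (l k : nat) : (k <= l)%N ->
  (#|[pred z : 'M[F]_l | \rank z == l - k]| * qfact #|F| k <= #|F| ^ (l * l))%N.
Proof.
move=> kl.
pose kerU (z : 'M[F]_l) := #|[pred U : 'M[F]_(k, l) | row_free U && (U *m z == 0)]|.
apply: (@leq_trans (\sum_(z : 'M[F]_l | \rank z == (l - k)%N) kerU z)%N).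
  rewrite -sum1_card big_distrl /=; apply: leq_sum => z /eqP rz.
  rewrite mul1n.
  have rk : \rank (kermx z) = k by rewrite mxrank_ker rz subKn.
  (* If [B] is a basis of the left kernel of [z], so is [g *m B] for every invertible [g]. The power
     of [#|F|] in the order of GL_k is then given up. *)
  apply: (@leq_trans #|[pred g : 'M[F]_k | g \in unitmx]|).
    by rewrite card_unitmx leq_pmull // expn_gt0 ltnW // finNzRing_gt1.
  move: (row_base (kermx z)) (row_base_free (kermx z)) (eq_row_base (kermx z)).
  rewrite rk => B Bfree eqB.
  rewrite -(fintype.card_image (f := mulmx^~ B)); last first.
    by move=> x y /(row_free_inj Bfree).
  apply: subset_leq_card; apply/fintype.subsetP => U /fintype.imageP[g]; rewrite !inE => gu ->.
  rewrite /row_free mxrankMfree // -row_free_unit in gu *.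
  rewrite -[_ == k]/(row_free g) gu -mulmxA;
    have /sub_kermxP -> : (B <= kermx z)%MS by rewrite eqB.
  by rewrite mulmx0 eqxx.
under eq_bigr => z _ do rewrite /kerU -sum1_card big_mkcond.
rewrite exchange_big /=.
(* For a row-free [U] the columns of [z] range over a space of dimension [l - k]; the rank condition
   on [z] is dropped. *)
apply: (@leq_trans (\sum_(U : 'M[F]_(k, l)) #|F| ^ (l * (l - k))))%N.
  apply: leq_sum => U _; rewrite -big_mkcondr /=.
  have [Ufree|nU] := boolP (row_free U); last by rewrite big1 // => z /andP[];
    rewrite inE (negbTE nU).
  have -> : (l - k)%N = \rank (kermx U^T) by rewrite mxrank_ker mxrank_tr (eqP Ufree).
  rewrite -(card_submx l) sum1_card.
  rewrite -(fintype.card_image (f := trmx) (can_inj (@trmxK _ l l))).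
  apply: subset_leq_card; apply/fintype.subsetP => U' /fintype.imageP[z];
    rewrite !inE => /and3P[_ _ /eqP Uz] ->.
  by apply/sub_kermxP; rewrite -trmx_mul Uz trmx0.
rewrite sum_nat_const card_mx -expnD leq_exp2l ?finNzRing_gt1 //.
by nia.
Qed.

End Submx.

(** * Fourier transform of the corank weight *)

(* As a function of the corank of an [l x l] matrix over [F_q], this is up to a
   scalar the Fourier transform of the indicator function of [GL_l(F_q)]; the
   value at corank [0] is [1]. *)
Definition corank_weight (q k : nat) : int := \prod_(i < k) (1 - q%:Z ^+ i.+1).

Lemma norm_corank_weight (q k : nat) : (0 < q)%N ->
  `|corank_weight q k| = (qfact q k)%:Z.
Proof.
move=> q0; rewrite /corank_weight /qfact normr_prod.
elim/big_ind2: _ => // [x m y n -> -> //|i _].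
have : (1 <= q ^ i.+1)%N by rewrite expn_gt0 q0.
rewrite -natrXE; lia.
Qed.

(** For rank one, the row factor of the echelon factorisation is a nonzero scalar, which the column
    factor absorbs. This normalises both the first column in the Fourier recursion and the
    right-hand side of the linear system. *)
Lemma first_col_of_unit (F : fieldType) (n : nat) (b : 'cV[F]_(1 + n)) : b != 0 ->
  exists2 h, h \in unitmx & b = h *m col_mx 1%:M 0.
Proof.
move=> b0; have r1 : \rank b = 1%N.
  by apply/eqP; rewrite eqn_leq rank_leq_col lt0n mxrank_eq0.
have := mulmx_ebase b; rewrite r1.
have := row_ebase_unit b; rewrite [row_ebase b]mx11_scalar; set a := _ 0 0.
rewrite unitmxE det_scalar1 => ua eb.
exists (a *: col_ebase b).
  by rewrite unitmxZ // col_ebase_unit.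
rewrite -scalemxAl -{1}eb mul_mx_scalar; congr (_ *: (_ *m _)).
by apply/matrixP => i j; rewrite !mxE ord1; case: splitP => k ik;
   rewrite !mxE !ik ?ord1.
Qed.

Section Characters.
Variables (F : finFieldType) (chi : F -> algC).
Hypothesis chiD : forall a b, chi (a + b) = chi a * chi b.
Hypothesis norm_chi : forall a, `|chi a| = 1.
Variable a0 : F.
Hypothesis chi_a0 : chi a0 != 1.
Local Notation q := #|F|.

Lemma chi0 : chi 0 = 1.
Proof.
have n0 : chi 0 != 0 by rewrite -normr_eq0 norm_chi oner_eq0.
by apply: (mulfI n0); rewrite -chiD addr0 mulr1.
Qed.

Lemma chi_conj a : (chi a)^* = chi (- a).
Proof.
have n0 : chi a != 0 by rewrite -normr_eq0 norm_chi oner_eq0.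
by apply: (mulfI n0); rewrite -normCK norm_chi -chiD subrr chi0 expr1n.
Qed.

(** Translation by a vector that [phi] sends to [a0] multiplies the sum by [chi a0], which is not
    1. *)
Lemma sum_chi_eq0 (m n : nat) (phi : 'M[F]_(m, n) -> F) (u : 'M[F]_(m, n)) :
  {morph phi : x y / x + y} -> (forall a x, phi (a *: x) = a * phi x) ->
  phi u != 0 -> \sum_x chi (phi x) = 0.
Proof.
move=> phiD phiZ phiu.
pose v := (a0 / phi u) *: u.
have phiv : phi v = a0 by rewrite phiZ divfK.
have E : \sum_x chi (phi x) = chi a0 * \sum_x chi (phi x).
  rewrite {1}(reindex_inj (addrI v)) /= mulr_sumr; apply: eq_bigr => x _.
  by rewrite phiD phiv chiD.
move/eqP: E; rewrite eq_sym -subr_eq0 -{2}[\sum_x _]mul1r -mulrBl mulf_eq0 subr_eq0.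
by rewrite (negbTE chi_a0) => /eqP.
Qed.

Lemma sum_chi_mulmx (n : nat) (sigma : 'cV[F]_n) :
  \sum_(zeta : 'rV_n) chi ((zeta *m sigma) 0 0) = (q ^ n * (sigma == 0))%:R.
Proof.
have [->|s0] := eqVneq sigma 0.
  rewrite (eq_bigr (fun=> 1)) => [|z _]; last by rewrite mulmx0 mxE chi0.
  by rewrite sumr_const card_mx mul1n muln1.
have [i si] : exists i, sigma i 0 != 0.
  apply/existsP; apply: contraR s0; rewrite negb_exists => /forallP H.
  by apply/eqP/matrixP => i j; rewrite ord1 mxE; apply/eqP; move: (H i); rewrite negbK.
rewrite muln0; apply: (sum_chi_eq0 (u := delta_mx 0 i)) => [x y|a x|].
- by rewrite mulmxDl mxE.
- by rewrite -scalemxAl mxE.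
- by rewrite -rowE mxE.
Qed.

Lemma sum_chi_trace (n : nat) (d : 'M[F]_n) :
  \sum_(s : 'M[F]_n) chi (\tr (s *m d)) = (q ^ (n * n) * (d == 0))%:R.
Proof.
have [->|d0] := eqVneq d 0.
  rewrite (eq_bigr (fun=> 1)) => [|z _]; last by rewrite mulmx0 mxtrace0 chi0.
  by rewrite sumr_const card_mx muln1.
have /existsP[i /existsP[j dij]] : [exists i, exists j, d i j != 0].
  apply: contraR d0; rewrite negb_exists => /forallP H.
  apply/eqP/matrixP => i j; rewrite mxE; apply/eqP; move: (H i); apply: contraR => dij.
  by apply/existsP; exists j.
rewrite muln0; apply: (sum_chi_eq0 (u := delta_mx j i)) => [x y|a x|].
- by rewrite mulmxDl mxtraceD.
- by rewrite -scalemxAl mxtraceZ.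
- rewrite mxtrace_mulC /mxtrace (bigD1 i) //= big1 => [|k ki].
    rewrite mxE (bigD1 j) //= big1 => [|k kj].
      by rewrite mxE !eqxx mulr1 !addr0.
    by rewrite mxE (negbTE kj) mulr0.
  by rewrite mxE big1 // => k' _; rewrite mxE (negbTE ki) andbF mulr0.
Qed.

Lemma sum_chi_submx (m n : nat) (A : 'M[F]_(m, n)) (sigma : 'cV[F]_n) :
  \sum_(zeta : 'rV_n | (zeta <= A)%MS) chi ((zeta *m sigma) 0 0) =
  (q ^ \rank A * (A *m sigma == 0))%:R.
Proof.
rewrite sum_submx; under eq_bigr => y _ do rewrite -mulmxA.
rewrite sum_chi_mulmx; congr (_ * _)%:R; congr nat_of_bool.
rewrite -!submx0; apply/idP/idP => H; apply: submx_trans H; apply: submxMr;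
  by rewrite eq_row_base.
Qed.

Local Notation wt l z := ((corank_weight q (l - \rank z%R))%:~R : algC).

(* Adding a first row to [z] lowers the corank by one unless the row lies in the
   row space of [z]; the weight is such that the two contributions cancel for
   [sigma = 0], which restricts the Fourier transform to smaller matrices. *)
Lemma sum_first_row (l : nat) (sigma : 'cV[F]_(1 + l)) (z : 'M[F]_(l, 1 + l)) :
  \sum_(zeta : 'rV_(1 + l)) wt (1 + l) (col_mx zeta z) * chi ((zeta *m sigma) 0 0) =
  - (q%:R ^+ (1 + l) * ((sigma != 0) && (z *m sigma == 0))%:R * wt l z).
Proof.
have rl : (\rank z <= l)%N by apply: rank_leq_row.
set k := (l - \rank z)%N.
pose w := (corank_weight q k)%:~R : algC.
have E (zeta : 'rV_(1 + l)) : wt (1 + l) (col_mx zeta z) =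
    w * (1 - (if (zeta <= z)%MS then q%:R ^+ k.+1 else 0)).
  rewrite rank_col_mx_row; case: (_ <= _)%MS => /=.
    have -> : (1 + l - (\rank z + 0) = k.+1)%N by rewrite addn0 /k; lia.
    by rewrite /corank_weight big_ord_recr /= intrM intrB -/(corank_weight q k) rmorphXn.
  by rewrite subr0 mulr1 addn1.
under eq_bigr => zeta _ do rewrite E -mulrA.
rewrite -mulr_sumr.
under eq_bigr => zeta _ do rewrite mulrBl mul1r.
rewrite sumrB sum_chi_mulmx.
rewrite (eq_bigr (fun zeta =>
  if (zeta <= z)%MS then q%:R ^+ k.+1 * chi ((zeta *m sigma) 0 0) else 0)); last first.
  by move=> zeta _; case: ifP => // _; rewrite mul0r.
rewrite -big_mkcond -mulr_sumr sum_chi_submx !natrM !natrX (mulrA (_ ^+ k.+1)) -exprD.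
have -> : (k.+1 + \rank z = 1 + l)%N by rewrite /k; lia.
rewrite /w.
have [->|s0] := eqVneq sigma 0; first by rewrite mulmx0 eqxx /= subrr !mulr0 mul0r oppr0.
by rewrite /= mulr0 sub0r mulrN mulrC.
Qed.

(** Induction on [l]: summing over the first row of [z] either gives 0 or leaves, up to sign,
    [q ^ (1 + l)] times a transform of size [l]. The exponents 1, ..., l add up to ['C(l.+1, 2)]. *)
Lemma fourier_corank_weight (l : nat) (s : 'M[F]_l) :
  `|\sum_(z : 'M[F]_l) wt l z * chi (\tr (s *m z))| <= q%:R ^+ 'C(l.+1, 2).
Proof.
elim: l s => [|l IH] s.
  rewrite (big_pred1 0) => [|z]; last by apply/esym/eqP; rewrite [z]flatmx0.
  by rewrite mulmx0 mxtrace0 chi0 mxrank0 /corank_weight big_ord0 mulr1 normr1.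
rewrite -[l.+1]/(1 + l)%N in s *.
rewrite -[s]hsubmxK; move: (lsubmx s) (rsubmx s) => sigma s0.
rewrite (reindex (fun x : 'rV[F]_(1 + l) * 'M[F]_(l, 1 + l) => col_mx x.1 x.2)); last first.
  exists (fun z => (usubmx z, dsubmx z)) => [[z1 z2] _|z _] /=.
    by rewrite col_mxKu col_mxKd.
  by rewrite vsubmxK.
rewrite -(pair_bigA _ (fun z1 z2 =>
  wt (1 + l) (col_mx z1 z2) * chi (\tr (row_mx sigma s0 *m col_mx z1 z2)))) /=.
rewrite exchange_big /=.
under eq_bigr => z0 _.
  under eq_bigr => zeta _ do
    rewrite mul_row_col mxtraceD chiD mxtrace_mulC /mxtrace big_ord1 mulrA -/(mxtrace _).
  rewrite -mulr_suml sum_first_row; over.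
have [->|sigma0] := eqVneq sigma 0.
  rewrite big1 => [|z0 _]; last by rewrite /= mulr0 mul0r oppr0 mul0r.
  by rewrite normr0 exprn_ge0 // ler0n.
have [h hu sigmaE] := first_col_of_unit sigma0.
have E : \sum_(z0 : 'M[F]_(l, 1 + l)) - (q%:R ^+ (1 + l) * (true && (z0 *m sigma == 0))%:R
      * wt l z0)
    * chi (\tr (s0 *m z0)) =
  - (q%:R ^+ (1 + l) * \sum_(z : 'M[F]_l) wt l z * chi (\tr (dsubmx (invmx h *m s0) *m z))).
  rewrite mulr_sumr -sumrN.
  rewrite (bigID (fun z0 : 'M[F]_(l, 1 + l) => z0 *m sigma == 0)) /= [X in _ + X]big1 ?addr0;
    last first.
    by move=> z0 /negbTE ->; rewrite mulr0 mul0r oppr0 mul0r.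
  (* In the coordinates given by [h], the condition [z0 *m sigma = 0] says that the first column of
     [z0 *m h] vanishes; the other columns form a free square matrix. *)
  rewrite (reindex_onto (fun z : 'M[F]_l => row_mx 0 z *m invmx h) (fun z0 =>
    rsubmx (z0 *m h))); last first.
    move=> z0 /eqP z0s; apply: (canLR (mulmxK hu)); rewrite -[RHS]hsubmxK; congr row_mx.
    move: z0s; rewrite sigmaE mulmxA -[z0 *m h in LHS]hsubmxK mul_row_col mulmx1 mulmx0 addr0.
    by move=> ->.
  apply: eq_big => [z|z _].
    by rewrite sigmaE mulmxA mulmxKV // mul_row_col mul0mx mulmx0 addr0 row_mxKr !eqxx.
  rewrite sigmaE [_ *m (h *m _)]mulmxA mulmxKV // mul_row_col mul0mx mulmx0 addr0 eqxx mulr1.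
  rewrite mxrankMfree ?row_free_unit ?unitmx_inv // rank_row_0mx.
  rewrite mulNr -mulrA; congr (- (_ * (_ * chi _))).
  rewrite mulmxA mxtrace_mulC mulmxA -[invmx h *m s0 in LHS]vsubmxK.
  by rewrite mul_col_row mulmx0 mxtrace_block mxtrace0 add0r.
rewrite E normrN normrM normrX normr_nat binS bin1 [('C(_, 2) + _)%N]addnC [X in _ <= X]exprD.
by apply: ler_wpM2l; rewrite ?IH ?exprn_ge0 ?ler0n.
Qed.

(** Parseval's identity for the indicator function of [A]. *)
Lemma sum_sqr_norm_chi (l : nat) (A : {pred 'M[F]_l}) :
  \sum_(s : 'M[F]_l) `|\sum_(x in A) chi (\tr (s *m x))| ^+ 2 = (q ^ (l * l) * #|A|)%:R.
Proof.
rewrite (eq_bigr (fun s => \sum_(x in A) \sum_(y in A) chi (\tr (s *m (x - y))))); last first.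
  move=> s _; rewrite normCK rmorph_sum mulr_suml; apply: eq_bigr => x _.
  by rewrite mulr_sumr; apply: eq_bigr => y _; rewrite /= chi_conj -chiD mulmxBr raddfB.
rewrite exchange_big /= (eq_bigr (fun=> (q ^ (l * l))%:R)) => [|x Ax].
  by rewrite sumr_const natrM mulr_natr.
rewrite exchange_big /= (bigD1 x) //= sum_chi_trace subrr eqxx muln1 big1 ?addr0 // =>
  y /andP[_ yx].
by rewrite sum_chi_trace subr_eq0 eq_sym (negbTE yx) muln0.
Qed.

Lemma fourier_inversion (l : nat) (G : 'M[F]_l -> algC) (z : 'M[F]_l) :
  (q ^ (l * l))%:R * G z =
  \sum_(s : 'M[F]_l) (\sum_(z' : 'M[F]_l) G z' * chi (\tr (s *m z'))) * chi (\tr (s *m (- z))).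
Proof.
under eq_bigr => s _.
  rewrite mulr_suml.
  under eq_bigr => z' _ do rewrite -mulrA -chiD -mxtraceD -mulmxDr.
  over.
rewrite exchange_big /= (bigD1 z) //= [X in _ + X]big1 ?addr0 => [|y yz];
  rewrite -mulr_sumr sum_chi_trace.
  by rewrite subrr eqxx muln1 mulrC.
by rewrite subr_eq0 (negbTE yz) muln0 mulr0.
Qed.

(** Expanding the weight in characters splits the sum over the rectangle into a product of the
    transforms of [A] and [B] at each frequency. The weight's transform is bounded pointwise and the
    other two by Parseval. *)
Lemma rectangle_corank_weight (l : nat) (A B : {pred 'M[F]_l}) :
  `|\sum_(x in A) \sum_(y in B) wt l (x + y)| <= (q ^ (l * l + 'C(l.+1, 2)))%:R.
Proof.
have Q0 : 0 < (q ^ (l * l))%:R :> algC.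
  by rewrite ltr0n expn_gt0 ltnW // finNzRing_gt1.
rewrite -(ler_pM2l Q0) -{1}(ger0_norm (ltW Q0)) -normrM mulr_sumr.
pose a (D : {pred 'M[F]_l}) s := \sum_(x in D) chi (\tr (- s *m x)).
have -> : \sum_(x in A) (q ^ (l * l))%:R * \sum_(y in B) wt l (x + y) =
    \sum_(s : 'M[F]_l) (\sum_(z : 'M[F]_l) wt l z * chi (\tr (s *m z))) * (a A s * a B s).
  under eq_bigr => x _.
    rewrite mulr_sumr.
    under eq_bigr => y _ do rewrite (fourier_inversion (fun z => wt l z)).
    over.
  under eq_bigr => x _ do rewrite exchange_big /=.
  rewrite exchange_big /=; apply: eq_bigr => s _.
  rewrite [a A s * _]mulr_suml mulr_sumr; apply: eq_bigr => x _.
  rewrite -mulr_sumr; congr (_ * _); rewrite mulr_sumr; apply: eq_bigr => y _.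
  by rewrite -chiD -mxtraceD -mulmxDr mulmxN mulNmx.
apply: le_trans (ler_norm_sum _ _ _) _.
(* The arithmetic-geometric mean inequality replaces Cauchy-Schwarz, since both [A] and [B] are only
   bounded by the size of the whole space. *)
apply: (@le_trans _ _ (\sum_(s : 'M[F]_l) q%:R ^+ 'C(l.+1, 2) / 2 *
  (`|a A s| ^+ 2 + `|a B s| ^+ 2))).
  apply: ler_sum => s _; rewrite normrM -mulrA; apply: ler_pM => //.
    exact: fourier_corank_weight.
  rewrite normrM [X in _ <= X]mulrC ler_pdivlMr // -subr_ge0.
  have : 0 <= (`|a A s| - `|a B s|) ^+ 2.
    by rewrite real_exprn_even_ge0 // rpredB // normr_real.
  by congr (0 <= _); ring.
have card_le (D : {pred 'M[F]_l}) : \sum_s `|a D s| ^+ 2 <= (q ^ (l * l) * q ^ (l * l))%:R.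
  rewrite (reindex_inj (@oppr_inj _)) /=.
  rewrite /a; under eq_bigr => s _ do rewrite opprK.
  rewrite sum_sqr_norm_chi ler_nat leq_mul2l -card_mx max_card orbT //.
rewrite -mulr_sumr big_split /=.
apply: (@le_trans _ _ (q%:R ^+ 'C(l.+1, 2) / 2 * ((q ^ (l * l) * q ^ (l * l))%:R *+ 2))).
  apply: ler_wpM2l; first by rewrite divr_ge0 ?exprn_ge0 ?ler0n.
  by rewrite mulr2n; apply: lerD.
rewrite -[_%:R *+ 2]mulr_natr mulrA mulrAC divfK ?pnatr_eq0 // -natrX -!natrM expnD.
by rewrite ler_nat; apply/eq_leq; ring.
Qed.

End Characters.

Lemma Fp_character (p : nat) : prime p ->
  exists2 chi : 'F_p -> algC,
    (forall a b, chi (a + b) = chi a * chi b) /\ (forall a, `|chi a| = 1) & chi 1 != 1.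
Proof.
move=> p_pr; have [w pw] := C_prim_root_exists (prime_gt0 p_pr).
exists (fun a => w ^+ a).
  split=> [a b|a].
    by rewrite -exprD /= [X in w ^+ (_ %% X)]Fp_cast // prim_expr_mod.
  have /eqP : `|w| ^+ p = 1 by rewrite -normrX (prim_expr_order pw) normr1.
  by rewrite pexpr_eq1 ?prime_gt0 // normrX => /eqP ->; rewrite expr1n.
rewrite -[X in _ != X](expr0 w) (eq_prim_root_expr pw) /=.
by rewrite mod0n modn_small ?Fp_cast // ?modn_small ?prime_gt1.
Qed.

(** Characters live in [algC], but the bound is integral and is therefore stated over the integers,
    whence it can be mapped into the reals. *)
Lemma rectangle_bound (p l : nat) (A B : {pred 'M['F_p]_l}) : prime p ->
  `|\sum_(x in A) \sum_(y in B) corank_weight p (l - \rank (x + y)%R)|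
     <= (p ^ (l * l + 'C(l.+1, 2)))%:Z.
Proof.
move=> p_pr; have [chi [chiD nchi] chi1] := Fp_character p_pr.
have := rectangle_corank_weight chiD nchi chi1 A B.
rewrite card_Fp //.
under eq_bigr => x _ do rewrite -rmorph_sum /=.
by rewrite -rmorph_sum /= -intr_norm pmulrn ler_int.
Qed.

(** * Protocols and the embedding *)

(** Each bit cuts the current rectangle in two, so at most [2 ^ c] rectangles of constant output
    arise. Rectangles are taken in the index sets [I] and [J], from which the inputs are computed
    separately. *)
Lemma protocol_sign_bound (R : numDomainType) (X Y : Type) (I J : finType)
    (alpha : I -> X) (beta : J -> Y) (f : I -> J -> R) (D : R) :
  (forall (A : pred I) (B : pred J), `|\sum_(i | A i) \sum_(j | B j) f i j| <= D) ->
  forall (pi : protocol X Y bool) (c : nat) (A : pred I) (B : pred J),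
  (forall i j, A i -> B j -> (bits pi (alpha i) (beta j) <= c)%N) ->
  `|\sum_(i | A i) \sum_(j | B j) f i j * (-1) ^+ run pi (alpha i) (beta j)|
    <= 2 ^+ c * D.
Proof.
move=> fD; have D0 : 0 <= D by apply: le_trans (fD pred0 pred0); rewrite normr_ge0.
elim=> [z c A B _|a pi1 IH1 pi0 IH0 c A B cost|a pi1 IH1 pi0 IH0 c A B cost] /=.
- under eq_bigr => i _ do rewrite -mulr_suml.
  rewrite -mulr_suml mulrC normrMsign; apply: le_trans (fD _ _) _.
  by rewrite ler_peMl // exprn_ege1 // ler1n.
(* A node that sends a bit within budget 0 is reached by no pair of the rectangle, so the sum is
   empty. *)
- case: c cost => [|c] cost.
    rewrite big1 ?normr0 ?mulr_ge0 ?exprn_ge0 // => i Ai.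
    by rewrite big1 // => j Bj; have := cost i j Ai Bj.
  rewrite (bigID (fun i => a (alpha i))) /= exprS -mulrA mulr2n mulrDl mul1r.
  apply: le_trans (ler_normD _ _) _; apply: lerD.
    rewrite (eq_bigr (fun i => \sum_(j | B j) f i j * (-1) ^+ run pi1 (alpha i) (beta j))).
      by apply: IH1 => i j /andP[Ai ai] Bj; have := cost i j Ai Bj; rewrite /= ai.
    by move=> i /andP[_ ->].
  rewrite (eq_bigr (fun i => \sum_(j | B j) f i j * (-1) ^+ run pi0 (alpha i) (beta j))).
    by apply: IH0 => i j /andP[Ai /negbTE ai] Bj; have := cost i j Ai Bj; rewrite /= ai.
  by move=> i /andP[_ /negbTE ->].
- case: c cost => [|c] cost.
    rewrite big1 ?normr0 ?mulr_ge0 ?exprn_ge0 // => i Ai.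
    by rewrite big1 // => j Bj; have := cost i j Ai Bj.
  rewrite exchange_big (bigID (fun j => a (beta j))) /= exprS -mulrA mulr2n mulrDl mul1r.
  apply: le_trans (ler_normD _ _) _; apply: lerD.
    rewrite (eq_bigr (fun j => \sum_(i | A i) f i j * (-1) ^+ run pi1 (alpha i) (beta j))).
      rewrite exchange_big; apply: IH1 => i j Ai /andP[Bj aj].
      by have := cost i j Ai Bj; rewrite /= aj.
    by move=> j /andP[_ ->].
  rewrite (eq_bigr (fun j => \sum_(i | A i) f i j * (-1) ^+ run pi0 (alpha i) (beta j))).
    rewrite exchange_big; apply: IH0 => i j Ai /andP[Bj /negbTE aj].
    by have := cost i j Ai Bj; rewrite /= aj.
  by move=> j /andP[_ /negbTE ->].
Qed.

Section Encoding.
Variables (F : fieldType) (n : nat).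
Implicit Types (h : 'M[F]_(1 + n)) (rho : 'rV[F]_n) (v w : 'cV[F]_n) (c : 'M[F]_1)
  (M : 'M[F]_n).

(* For [c = 1] and [w = M *m v] this is a matrix [z] with [z *m t = h e_1] where
   [t = encode_sol rho v]; it does not change when a kernel vector of [M] is
   added to [v], whereas [t 0 0] does unless [rho] vanishes on that vector. *)
Definition encode h rho c w M : 'M[F]_(1 + n) :=
  h *m block_mx c 0 w M *m block_mx 1%:M rho 0 1%:M.

(** Additivity for fixed [h] and [rho] lets each player encode a share of [z] without
    communication. *)
Lemma encodeD h rho c1 w1 M1 c2 w2 M2 :
  encode h rho (c1 + c2) (w1 + w2) (M1 + M2) =
  encode h rho c1 w1 M1 + encode h rho c2 w2 M2.
Proof. by rewrite /encode -mulmxDl -mulmxDr add_block_mx addr0. Qed.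

Lemma encode_unitmx h rho w M :
  h \in unitmx -> M \in unitmx -> encode h rho 1%:M w M \in unitmx.
Proof.
move=> hu Mu; rewrite /encode !unitmx_mul hu /= !unitmxE det_lblock det_ublock !det1.
by rewrite !mul1r unitr1 -unitmxE Mu.
Qed.

(** The preimage of the column (1, -v) under the unipotent right factor of [encode]. *)
Definition encode_sol rho v : 'cV[F]_(1 + n) := col_mx (1%:M + rho *m v) (- v).

Lemma encode_solP h rho v M :
  encode h rho 1%:M (M *m v) M *m encode_sol rho v = h *m col_mx 1%:M 0.
Proof.
rewrite /encode -!mulmxA /encode_sol; congr (_ *m _).
rewrite !mul_block_col !mul1mx !mul0mx mulmxN add0r addrK mulmxN.
by rewrite mulmx1 addr0 subrr.
Qed.

Lemma encode_sol00 rho v : encode_sol rho v 0 0 = 1 + (rho *m v) 0 0.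
Proof.
by rewrite /encode_sol mxE; case: splitP => // k _; rewrite ord1 mxE [X in X + _ = _]mxE.
Qed.

End Encoding.

Lemma solve_linear_system_answer (p n : nat) (b t : 'cV['F_p]_n.+1) (x y : 'M['F_p]_n.+1) :
  (x + y) \in unitmx -> (x + y) *m t = b ->
  answer (solve_linear_system b) x y = (t 0 0 == 0).
Proof.
move=> u zt; apply/existsP/idP => [[t' /andP[/eqP zt' t'0]]|t0].
  by have <- : t' = t by apply: (can_inj (mulKmx u)); rewrite zt zt'.
by exists t; rewrite zt eqxx.
Qed.

Section Diag4.
Variables (F : fieldType) (l r : nat).

(* Repeating [z] multiplies its corank by four, so that singular [z] are damped
   by a factor [q ^- 4] per unit of corank, which is enough even for [q = 2]. *)
Definition diag4 (z : 'M[F]_l) (e : 'M[F]_r) : 'M[F]_(l + (l + (l + (l + r)))) :=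
  block_mx z 0 0 (block_mx z 0 0 (block_mx z 0 0 (block_mx z 0 0 e))).

Lemma diag4D z1 e1 z2 e2 : diag4 (z1 + z2) (e1 + e2) = diag4 z1 e1 + diag4 z2 e2.
Proof. by rewrite /diag4 !add_block_mx !addr0. Qed.

Lemma rank_diag4 z e : \rank (diag4 z e) = (4 * \rank z + \rank e)%N.
Proof. by rewrite /diag4 !rank_diag_block_mx; lia. Qed.

End Diag4.

(** * Cancellation over the solutions of a singular embedding *)

Section Cancellation.
Variables (R : numDomainType) (F : finFieldType).

(* The weight of an answer by the first coordinate [a] of the solution; signs
   follow the convention that the Boolean output [true] counts as [-1]. *)
Definition balanced_sign (a : F) : R := if a == 0 then 1 - #|F|%:R else 1.

Lemma sum_balanced_sign : \sum_a balanced_sign a = 0.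
Proof.
rewrite (bigD1 0) //= /balanced_sign eqxx (eq_bigr (fun=> 1)) => [|a /negbTE-> //].
rewrite sumr_const cardC1 -subn1 natrB; last by rewrite ltnW // finNzRing_gt1.
by rewrite addrA subrK subrr.
Qed.

Lemma balanced_signE a : balanced_sign a = `|balanced_sign a| * (-1) ^+ (a == 0).
Proof.
rewrite /balanced_sign; case: eqP => _; rewrite ?normr1 ?mulr1 //.
by rewrite ler0_norm ?subr_le0 ?ler1n ?mulrN1 ?opprK // ltnW // finNzRing_gt1.
Qed.

Lemma norm_balanced_sign a : 1 <= `|balanced_sign a| <= #|F|%:R.
Proof.
have q1 := finNzRing_gt1 F.
rewrite /balanced_sign; case: eqP => _; rewrite ?normr1 ?lexx ?ler1n ?(ltnW q1) //.
rewrite distrC ger0_norm ?subr_ge0 ?ler1n ?(ltnW q1) // lerBlDr lerDl ler01 andbT.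
by rewrite lerBrDr -(natrD R 1 1) ler_nat.
Qed.

Variable n : nat.

(** If [rho] lies outside the row space of [M], some kernel vector [u] of [M] has [rho *m u]
    nonzero. Moving [v] along [u] fixes the encoded matrix while the first coordinate of the
    solution runs through [F], so the sum over [v] is 0. The other [rho] are bounded trivially. *)
Lemma encode_cancellation (h : 'M[F]_(1 + n)) (M : 'M[F]_n) (G : 'M[F]_(1 + n) -> R) (g : R) :
  (forall z, `|G z| <= g) ->
  `|\sum_(rho : 'rV_n) \sum_(v : 'cV_n)
      balanced_sign (1 + (rho *m v) 0 0) * G (encode h rho 1%:M (M *m v) M)|
  <= (#|F| ^ (1 + n + \rank M))%:R * g.
Proof.
move=> Gg; pose term rho v : R :=
  balanced_sign (1 + (rho *m v) 0 0) * G (encode h rho 1%:M (M *m v) M).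
have g0 : 0 <= g by apply: le_trans (Gg 0); rewrite normr_ge0.
rewrite (bigID (fun rho : 'rV_n => (rho <= M)%MS)) /= [X in _ + X]big1 ?addr0.
  apply: le_trans (ler_norm_sum _ _ _) _.
  apply: (@le_trans _ _ (\sum_(rho : 'rV[F]_n | (rho <= M)%MS) (#|F| ^ (1 + n))%:R * g)).
    apply: ler_sum => rho _; apply: le_trans (ler_norm_sum _ _ _) _.
    apply: (@le_trans _ _ (\sum_(v : 'cV[F]_n) #|F|%:R * g)).
      apply: ler_sum => v _; rewrite normrM ler_pM //.
      by case/andP: (norm_balanced_sign (1 + (rho *m v) 0 0)).
    by rewrite sumr_const card_mx muln1 add1n expnS natrM mulrAC mulr_natr.
  rewrite sumr_const -[leLHS]mulr_natr mulrAC -natrM expnD.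
  by rewrite (card_submx 1 M) [(1 * _)%N]mul1n -!expnD.
move=> rho; rewrite submxE => nsub.
have /existsP[j nj] : [exists j, (rho *m cokermx M) 0 j != 0].
  apply: contraR nsub; rewrite negb_exists => /forallP H; apply/eqP/matrixP => i j.
  by rewrite ord1 [RHS]mxE; apply/eqP; move: (H j); rewrite negbK.
pose u := col j (cokermx M).
have Mu : M *m u = 0 by rewrite /u colE mulmxA mulmx_coker mul0mx.
have ru : (rho *m u) 0 0 != 0 by rewrite /u colE mulmxA -colE mxE.
have q0 : #|F|%:R != 0 :> R by rewrite pnatr_eq0 -lt0n ltnW // finNzRing_gt1.
(* The sum over [v] is repeated once for each translate by [a *: u], with [a] in [F]. *)
apply: (mulfI q0); rewrite mulr0 mulr_natl -sumr_const.
rewrite (eq_bigr (fun a : F => \sum_v term rho (v + a *: u))) => [|a _]; last first.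
  by rewrite (reindex_inj (addIr (a *: u))).
rewrite exchange_big big1 //= => v _.
rewrite /term.
under eq_bigr => a _.
  rewrite !mulmxDr -!scalemxAr Mu scaler0 addr0 mxE [X in _ + (_ + X)]mxE addrA.
  over.
rewrite -mulr_suml -[RHS](mul0r (G (encode h rho 1%:M (M *m v) M))); congr (_ * _).
rewrite -[RHS]sum_balanced_sign.
rewrite [RHS](reindex (fun a => 1 + (rho *m v) 0 0 + a * (rho *m u) 0 0)) //=.
exists (fun a => (a - (1 + (rho *m v) 0 0)) / (rho *m u) 0 0) => a _ /=.
  by rewrite addrAC subrr add0r mulfK.
by rewrite divfK // addrC subrK.
Qed.

End Cancellation.

(** Grouping by corank k, the factor [qfact] cancels against [card_corank], and a geometric series
    over k >= 1 remains. *)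
Lemma sum_singular_weight (R : realFieldType) (F : finFieldType) (l : nat) :
  \sum_(z : 'M[F]_l | z \notin unitmx)
     (qfact #|F| (l - \rank z))%:R * (#|F|%:R / #|F|%:R ^+ (4 * (l - \rank z)))
  <= 2 / 15 * (#|F| ^ (l * l))%:R :> R.
Proof.
set q := #|F|; have q1 : (1 < q)%N := finNzRing_gt1 F.
have q0 : 0 < q%:R :> R by rewrite ltr0n ltnW.
pose cork (z : 'M[F]_l) : 'I_l.+1 := inord (l - \rank z).
have corkE z : cork z = (l - \rank z)%N :> nat by rewrite inordK // ltnS leq_subr.
pose Q : R := (q ^ (l * l))%:R.
rewrite (partition_big cork xpredT) //=.
(* The term q^(1-4k) is largest for q = 2, where it equals 2/16^k. *)
apply: (@le_trans _ _ (\sum_(k < l.+1) (if k == 0%N :> nat then 0 else 2 / 16 ^+ k * Q))).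
  apply: ler_sum => k _; case: eqP => [k0|/eqP k0].
    rewrite big1 // => z /andP[zu /eqP zk].
    move: k0; rewrite -zk corkE => /eqP; rewrite subn_eq0 => rz.
    by case/negP: zu; rewrite -row_free_unit /row_free eqn_leq rank_leq_row.
  have -> : \sum_(z | (z \notin unitmx) && (cork z == k))
      (qfact q (l - \rank z))%:R * (q%:R / q%:R ^+ (4 * (l - \rank z))) =
      (#|[pred z : 'M[F]_l | \rank z == l - k]%N| * qfact q k)%:R *
        (q%:R / q%:R ^+ (4 * k)) :> R.
    rewrite (eq_bigr (fun=> (qfact q k)%:R * (q%:R / q%:R ^+ (4 * k)))); last first.
      by move=> z /andP[_ /eqP <-]; rewrite corkE.
    rewrite sumr_const natrM -mulrA [RHS]mulr_natl; congr (_ *+ _).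
    apply: eq_card => z; rewrite !inE [LHS]/in_mem /=
      (_ : (cork z == k) = (cork z == k :> nat)) // corkE.
    have := rank_leq_row z; have := ltn_ord k.
    rewrite ltnS => kl rz; rewrite -row_free_unit /row_free.
    by apply/idP/idP; lia.
  rewrite [leRHS]mulrC; apply: ler_pM; rewrite ?ler0n ?divr_ge0 ?exprn_ge0 ?ler0n //.
    by rewrite ler_nat card_corank // -ltnS.
  case: (nat_of_ord k) k0 => // k' _.
  rewrite ler_pdivrMr ?exprn_gt0 // mulrAC ler_pdivlMr ?exprn_gt0 // -!natrX -!natrM ler_nat.
  rewrite (_ : 16 = 2 ^ 4)%N // -expnM mulnS !(expnS _ (3 + 4 * k')) mulnCA leq_mul2l /=.
  by rewrite leq_mul2l leq_exp2r ?q1 ?orbT.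
rewrite big_ord_recl /= add0r -mulr_suml.
rewrite ler_wpM2r ?ler0n //.
under eq_bigr => i _ do rewrite /bump /= add1n.
suff : \sum_(i < l) 2 / 16 ^+ i.+1 = 2 / 15 * (1 - 16 ^- l) :> R.
  move=> ->; rewrite -[leRHS]mulr1 ler_wpM2l ?divr_ge0 // gerBl invr_ge0 exprn_ge0 //.
elim: l {cork corkE Q} => [|l IH]; first by rewrite big_ord0 expr0 invr1 subrr mulr0.
by rewrite big_ord_recr /= IH exprS invfM; set x := 16 ^- l; field.
Qed.

(** * Averages over masks and coins *)

Lemma sum_sum_addr (R : nzRingType) (V : finZmodType) (phi : V -> R) :
  \sum_x \sum_y phi (x + y) = #|V|%:R * \sum_z phi z.
Proof.
rewrite (eq_bigr (fun=> \sum_z phi z)) => [|x _].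
  by rewrite sumr_const mulr_natl.
by rewrite [RHS](reindex_inj (addrI x)).
Qed.

(** The triangle inequality for a signed mixture, to be applied in turn to the random row, the
    random column, the mask and the coins. *)
Lemma mixture_bound (R : numDomainType) (I J K : finType) (f S : I -> J -> R)
    (a : K -> R) (s : K -> I -> J -> R) (D m : R) :
  (forall i j, S i j = \sum_k a k * s k i j) -> \sum_k `|a k| <= m -> 0 <= D ->
  (forall k, `|\sum_i \sum_j f i j * s k i j| <= D) ->
  `|\sum_i \sum_j f i j * S i j| <= m * D.
Proof.
move=> SE am D0 sD.
have -> : \sum_i \sum_j f i j * S i j = \sum_k a k * \sum_i \sum_j f i j * s k i j.
  under [RHS]eq_bigr => k _.
    rewrite mulr_sumr; under eq_bigr => i _ do rewrite mulr_sumr; over.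
  rewrite [RHS]exchange_big; apply: eq_bigr => i _.
  rewrite exchange_big; apply: eq_bigr => j _.
  by rewrite SE mulr_sumr; apply: eq_bigr => k _; rewrite mulrCA.
apply: le_trans (ler_norm_sum _ _ _) _; apply: (le_trans _ (ler_wpM2r D0 am)).
rewrite mulr_suml; apply: ler_sum => k _.
by rewrite normrM ler_wpM2l.
Qed.

Section Advantage.
Variables (R : realType) (V : finZmodType) (P : public_coin_protocol R V V bool).

(* The random mask [u] makes the transcript depend on [z] only, not on how the
   players' inputs split it. *)
Definition advantage (z : V) : R :=
  \sum_u \sum_w coin_prob P w * (-1) ^+ run (protocol_of_coins P w) (z + u) (- u).

Lemma norm_advantage z : `|advantage z| <= #|V|%:R.
Proof.
apply: le_trans (ler_norm_sum _ _ _) _.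
rewrite -[#|V|]sum1_card natr_sum; apply: ler_sum => u _.
apply: le_trans (ler_norm_sum _ _ _) _.
rewrite -[leRHS](coin_prob_sum1 P); apply: ler_sum => w _.
by rewrite mulrC normrMsign ger0_norm ?coin_prob_ge0.
Qed.

(** For each mask the correct coins count with sign +1 and the wrong ones with sign -1, which leaves
    at least (1 - delta) - delta. *)
Lemma advantage_ge (f : promise_problem V V bool) (z : V) (ans : bool) (delta : R) :
  solves delta f P -> (forall u, promise f (z + u) (- u)) ->
  (forall u, answer f (z + u) (- u) = ans) ->
  (1 - 2 * delta) * #|V|%:R <= (-1) ^+ ans * advantage z.
Proof.
move=> sol prom ansE.
rewrite mulr_natr -sumr_const /advantage mulr_sumr; apply: ler_sum => u _.
have := sol _ _ (prom u); rewrite /success_prob ansE => succ.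
have := coin_prob_sum1 P.
rewrite (bigID (fun w => run (protocol_of_coins P w) (z + u) (- u) == ans)) /=.
rewrite mulr_sumr [X in _ -> _ <= X](bigID (fun w =>
  run (protocol_of_coins P w) (z + u) (- u) == ans)) /=.
rewrite [in X in _ -> _ <= X + _](eq_bigr (coin_prob P)); last first.
  by move=> w /eqP ->; rewrite mulrCA -signr_addb addbb mulr1.
rewrite [in X in _ -> _ <= _ + X](eq_bigr (fun w => - coin_prob P w)); last first.
  move=> w; rewrite mulrCA -signr_addb => ne.
  have -> : ans (+) run (protocol_of_coins P w) (z + u) (- u) by clear -ne; case: ans ne;
    case: (run _ _ _).
  by rewrite expr1 mulrN1.
rewrite sumrN; set s1 := \sum_(_ | _ == _) _ in succ *; set s2 := \sum_(_ | ~~ _) _; lra.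
Qed.

End Advantage.

(** * Upper and lower bounds for the weighted advantage *)

Section HardDistribution.
Variables (R : realType) (p l r : nat).
Local Notation n := (l + (l + (l + (l + r))))%N.
Local Notation matrices := 'M['F_p]_(1 + n).
Variables (P : public_coin_protocol R matrices matrices bool) (h : matrices).
Hypothesis p_pr : prime p.

(** Neither this sum nor [advantage] is normalised, so the bounds below carry the numbers of choices
    [p ^ (n + n)] and [#|{: matrices}|]. *)
Definition mean_advantage (z : 'M['F_p]_l) : R :=
  \sum_(rho : 'rV_n) \sum_(v : 'cV_n) balanced_sign R (1 + (rho *m v) 0 0) *
    advantage P (encode h rho 1%:M (@diag4 _ l r z 1%:M *m v) (diag4 z 1%:M)).

(** Once [z] is split into two summands and [rho], [v], the mask and the coins are fixed, each input
    depends on one summand only, so the rectangle bound applies to the protocol. The extra factor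
    [p] bounds [balanced_sign]. *)
Lemma weighted_advantage_le :
  `|\sum_(z : 'M['F_p]_l) (corank_weight p (l - \rank z))%:~R * mean_advantage z|
  <= (p ^ (n + n + 1 + 'C(l.+1, 2)))%:R * #|{: matrices}|%:R * 2 ^+ worst_case_cost P.
Proof.
have p0 : (0 < p)%N := prime_gt0 p_pr.
pose W (z : 'M['F_p]_l) : R := (corank_weight p (l - \rank z))%:~R.
have Q0 : 0 < #|{: 'M['F_p]_l}|%:R :> R by rewrite ltr0n card_mx card_Fp // expn_gt0 p0.
rewrite -(ler_pM2l Q0) -{1}(ger0_norm (ltW Q0)) -normrM -sum_sum_addr.
(* Alice's share carries the constant parts of the encoding, the corner 1 and the identity padding;
   Bob's has 0 in both places. *)
pose A rho v u (z : 'M['F_p]_l) := encode h rho 1%:M (@diag4 _ l r z 1%:M *m v) (diag4 z 1%:M)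
  + u.
pose B rho v u (z : 'M['F_p]_l) := encode h rho 0 (@diag4 _ l r z 0 *m v) (diag4 z 0) - u.
pose T w rho v u z z' : R := (-1) ^+ run (protocol_of_coins P w) (A rho v u z) (B rho v u z').
pose D : R := 2 ^+ worst_case_cost P * (p ^ (l * l + 'C(l.+1, 2)))%:R.
have D0 : 0 <= D by rewrite mulr_ge0 ?exprn_ge0 ?ler0n.
have base w rho v u : `|\sum_z \sum_z' W (z + z') * T w rho v u z z'| <= D.
  apply: (@protocol_sign_bound R _ _ _ _ (A rho v u) (B rho v u)
    (fun z z' => W (z + z')) _ _ (protocol_of_coins P w) _ xpredT xpredT).
    move=> A' B'; have := rectangle_bound (l := l) A' B' p_pr.
    rewrite -(ler_int R) intr_norm rmorph_sum /=.
    under eq_bigr => x _ do rewrite rmorph_sum /=.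
    by rewrite -pmulrn.
  move=> z z' _ _; rewrite /worst_case_cost.
  apply: leq_trans (leq_bigmax w); apply: leq_trans (leq_bigmax (A rho v u z)).
  exact: (leq_bigmax (B rho v u z')).
have maskE rho v z z' :
    advantage P (encode h rho 1%:M (diag4 (z + z') 1%:M *m v) (diag4 (z + z') 1%:M)) =
    \sum_u \sum_w coin_prob P w * T w rho v u z z'.
  (* Shifting the mask by Bob's encoded share moves that share from Alice's input to Bob's. *)
  rewrite /advantage (reindex_inj (addIr (- encode h rho 0
    (@diag4 _ l r z' 0 *m v) (diag4 z' 0)))) /=.
  apply: eq_bigr => u _; apply: eq_bigr => w _; congr (_ * (-1) ^+ nat_of_bool (run _ _ _)).
    have := encodeD h rho 1%:M (@diag4 _ l r z 1%:M *m v) (diag4 z 1%:M) 0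
      (@diag4 _ l r z' 0 *m v) (diag4 z' 0).
    by rewrite -mulmxDl -diag4D !addr0 => ->; rewrite [u - _]addrC addrA addrK.
  by rewrite opprD opprK addrC.
have card_v : \sum_(k : 'cV['F_p]_n) 1 = (p ^ n)%:R :> R
  by rewrite sumr_const card_mx card_Fp // muln1.
have card_rho : \sum_(k : 'rV['F_p]_n) 1 = (p ^ n)%:R :> R
  by rewrite sumr_const card_mx card_Fp // mul1n.
apply: (@le_trans _ _ ((p ^ n)%:R * ((p ^ (n + 1))%:R *
  (#|{: 'M['F_p]_(1 + n)}|%:R * (1 * D))))).
  apply: (mixture_bound (a := fun _ : 'rV['F_p]_n => 1) (s := fun rho z z' =>
    \sum_(v : 'cV_n) balanced_sign R (1 + (rho *m v) 0 0) * \sum_u \sum_w coin_prob P w *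
      T w rho v u z z')).
  - move=> z z'; apply: eq_bigr => rho _; rewrite mul1r; apply: eq_bigr => v _.
    by rewrite maskE.
  - by under eq_bigr => k _ do rewrite normr1; rewrite card_rho.
  - by rewrite !mulr_ge0 ?ler0n ?ler01.
  move=> rho; apply: (mixture_bound (a := fun v : 'cV['F_p]_n =>
    balanced_sign R (1 + (rho *m v) 0 0))
    (s := fun v z z' => \sum_u \sum_w coin_prob P w * T w rho v u z z')) => //.
  - apply: (@le_trans _ _ (\sum_(v : 'cV['F_p]_n) p%:R)).
      apply: ler_sum => v _; case/andP: (norm_balanced_sign R (1 + (rho *m v) 0 0)).
      by rewrite card_Fp.
    by rewrite sumr_const card_mx card_Fp // muln1 addn1 expnSr natrM mulr_natl.
  - by rewrite !mulr_ge0 ?ler0n ?ler01.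
  move=> v; apply: (mixture_bound (a := fun=> 1) (s := fun u z z' =>
    \sum_w coin_prob P w * T w rho v u z z')).
  - by move=> z z'; apply: eq_bigr => u _; rewrite mul1r.
  - by under eq_bigr => k _ do rewrite normr1; rewrite sumr_const.
  - by rewrite mul1r.
  move=> u; apply: (mixture_bound (a := coin_prob P) (s := fun w z z' =>
    T w rho v u z z')) => //.
  rewrite -(coin_prob_sum1 P); apply: ler_sum => w _.
  by rewrite ger0_norm ?coin_prob_ge0.
have E : #|{: 'M['F_p]_l}|%:R * (p ^ (n + n + 1 + 'C(l.+1, 2)))%:R =
    (p ^ n)%:R * (p ^ (n + 1))%:R * (p ^ (l * l + 'C(l.+1, 2)))%:R :> R.
  by rewrite card_mx card_Fp // -!natrM -!expnD; congr (_ ^ _)%:R; lia.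
rewrite /D mul1r [leRHS]mulrA [X in _ <= X * _]mulrA E.
move: (p ^ n)%:R (p ^ (n + 1))%:R (_ ^ (l * l + _))%:R #|_|%:R (2 ^+ _) => x1 x2 x3 x4 x5.
by rewrite le_eqVlt; apply/orP; left; apply/eqP; clear; ring.
Qed.

Lemma weighted_advantage_ge (b : 'cV['F_p]_(1 + n)) :
  h \in unitmx -> b = h *m col_mx 1%:M 0 ->
  solves (1 / 20%:R) (solve_linear_system (n := n) b) P ->
  (p ^ (l * l))%:R / 12%:R * (p ^ (n + n))%:R * #|{: matrices}|%:R <=
  \sum_(z : 'M['F_p]_l) (corank_weight p (l - \rank z))%:~R * mean_advantage z.
Proof.
move=> hu bE sol; have p0 : (0 < p)%N := prime_gt0 p_pr.
set T := #|{: 'M['F_p]_(1 + n)}|%:R : R.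
have T0 : 0 <= T by rewrite ler0n.
pose W (z : 'M['F_p]_l) : R := (corank_weight p (l - \rank z))%:~R.
pose K := mean_advantage.
(* The factor 9/10 is 1 - 2/20; since [balanced_sign] has absolute value at least 1, its size can
   only help. *)
have unit_part (z : 'M['F_p]_l) : z \in unitmx -> (p ^ (n + n))%:R * (9 / 10 * T) <= W z * K z.
  move=> zu; have rz : \rank z = l by apply/eqP; rewrite -row_free_unit in zu.
  have Du : @diag4 _ l r z 1%:M \in unitmx.
    by rewrite -row_free_unit /row_free rank_diag4 rz mxrank1; apply/eqP; lia.
  rewrite /W /K rz subnn /corank_weight big_ord0 mul1r.
  apply: (@le_trans _ _ (\sum_(rho : 'rV['F_p]_n) \sum_(v : 'cV['F_p]_n) 9 / 10 * T)).
    rewrite !sumr_const !card_mx card_Fp // mul1n muln1 -mulrnA -expnD.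
    by rewrite -[leRHS]mulr_natl.
  apply: ler_sum => rho _; apply: ler_sum => v _.
  set E := encode _ _ _ _ _.
  have Eu : E \in unitmx by apply: encode_unitmx.
  have Et : E *m encode_sol rho v = b by rewrite encode_solP bE.
  have adv : 9 / 10 * T <= (-1) ^+ (1 + (rho *m v) 0 0 == 0 :> 'F_p) * advantage P E.
    have := @advantage_ge R _ P _ E (1 + (rho *m v) 0 0 == 0) _ sol.
    have sumE u : (E + u) + (- u) = E by rewrite addrK.
    rewrite (_ : 1 - 2 * (1 / 20%:R) = 9 / 10 :> R); last by field.
    apply=> u; first by rewrite /= sumE.
    rewrite -(encode_sol00 rho v); apply: solve_linear_system_answer; rewrite sumE //.
  rewrite balanced_signE -[leRHS]mulrA.
  apply: (le_trans adv); rewrite ler_peMl //; last first.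
    by case/andP: (norm_balanced_sign R (1 + (rho *m v) 0 0)).
  by apply: le_trans adv; rewrite mulr_ge0 // divr_ge0.
(* For [z] of corank k the embedded block has rank n - 4k, and the cancellation leaves
   [p ^ (1 + n + n - 4k)] times the bound [T]. *)
have singular_part (z : 'M['F_p]_l) :
    - ((qfact p (l - \rank z))%:R * (p%:R / p%:R ^+ (4 * (l - \rank z))) *
      ((p ^ (n + n))%:R * T)) <= W z * K z.
  rewrite lerNl; apply: le_trans (ler_norm _) _; rewrite normrN normrM.
  rewrite /W -intr_norm norm_corank_weight // -pmulrn -mulrA ler_wpM2l ?ler0n //.
  have Gg (y : 'M['F_p]_(1 + n)) : `|advantage P y| <= T by exact: norm_advantage.
  rewrite /K; apply: le_trans (encode_cancellation h (@diag4 _ l r z 1%:M) Gg) _.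
  rewrite mulrA ler_wpM2r // card_Fp // rank_diag4 mxrank1.
  rewrite mulrAC ler_pdivlMr ?exprn_gt0 ?ltr0n // -natrX -!natrM -expnD -expnS ler_nat
    leq_exp2l ?prime_gt1 //.
  by move: (rank_leq_row z); clear; move: (\rank z) => k; lia.
have := unitmx_lower_bound 'F_p l; have := sum_singular_weight R 'F_p l.
rewrite card_Fp // -sum1_card -(ler_nat R) natrM natr_sum.
set s := \sum_(_ | _ \notin _) _; set N0 := \sum_(i | _) 1%:R => s_le N0_ge.
rewrite (bigID (mem unitmx)) /=.
apply: (@le_trans _ _ (N0 * ((p ^ (n + n))%:R * (9 / 10 * T)) - s * ((p ^ (n + n))%:R * T))).
  have A0 : 0 <= (p ^ (n + n))%:R * T by rewrite mulr_ge0.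
  (* With [N0] at least a quarter of all matrices, 9/40 - 2/15 = 11/120 exceeds 1/12. *)
  have : 0 <= (9 / 10 * N0 - s - (p ^ (l * l))%:R / 12) * ((p ^ (n + n))%:R * T).
    apply: mulr_ge0 => //; have : 0 <= (p ^ (l * l))%:R :> R by [].
    by clear -s_le N0_ge; move: s N0 (p ^ _)%:R s_le N0_ge => s N0 Q; lra.
  clear; move: (p ^ (n + n))%:R (p ^ (l * l))%:R T N0 s => A Q T N0 s.
  by rewrite -[_ <= _ - _]subr_ge0; congr (0 <= _); field.
apply: lerD; first by rewrite mulr_suml; apply: ler_sum => z zu; rewrite mul1r;
  apply: unit_part.
by rewrite mulr_suml -sumrN; apply: ler_sum => z _; apply: singular_part.
Qed.

End HardDistribution.

(** * From the weighted advantage to the communication cost *)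

Lemma cost_lower_bound (R : realType) (p l r : nat)
    (n := (l + (l + (l + (l + r))))%N) (b : 'cV['F_p]_n.+1)
    (P : public_coin_protocol R 'M['F_p]_n.+1 'M['F_p]_n.+1 bool) :
  prime p -> b != 0 -> solves (1 / 20%:R) (solve_linear_system b) P ->
  (p ^ (l * l) <= 12 * 2 ^ worst_case_cost P * p ^ (1 + 'C(l.+1, 2)))%N.
Proof.
move=> p_pr b0 sol; have p0 : (0 < p)%N := prime_gt0 p_pr.
have [h hu bE] := first_col_of_unit b0.
have := le_trans (weighted_advantage_ge (l := l) (r := r) p_pr hu bE sol)
  (le_trans (ler_norm _) (weighted_advantage_le (l := l) (r := r) P h p_pr)).
rewrite -/n; set T := #|_|%:R => H.
have T0 : 0 < T :> R by rewrite ltr0n card_mx card_Fp // expn_gt0 p0.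
move: H; have -> : (p ^ (n + n + 1 + 'C(l.+1, 2)))%:R =
    (p ^ (n + n))%:R * (p ^ (1 + 'C(l.+1, 2)))%:R :> R by rewrite -natrM -expnD addnA.
rewrite [leRHS]mulrAC ler_pM2r // [leLHS]mulrC -[leRHS]mulrA ler_pM2l ?ltr0n ?expn_gt0 ?p0 //.
rewrite ler_pdivrMr // -natrX -!natrM ler_nat.
by rewrite [leqRHS]mulnC [X in (_ <= _ * X)%N]mulnC mulnA.
Qed.

Theorem theorem5p17 (R : realType) :
  exists2 c : R, 0 < c &
  exists n0 : nat, forall (p n : nat) (b : 'cV['F_p]_n.+1),
    prime p -> b != 0 -> (n0 <= n.+1)%N ->
    ((c * n.+1%:R ^+ 2 * ln p%:R)%:E
       <= Rpub (1 / 20%:R) (solve_linear_system b))%E.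
Proof.
exists (1 / 128); first by rewrite divr_gt0.
(* Dimension at least 33 means [n >= 32], hence [l >= 8]. The exponent [e] below equals l(l-1)/2 -
   5, and 128 times it then exceeds (4l+4)^2, a bound for the squared dimension. *)
exists 33 => p n b p_pr b0 n_ge.
apply/ereal_infP => _ [P sol ->]; rewrite lee_fin.
have p1 := prime_gt1 p_pr.
pose l := (n %/ 4)%N; pose r := (n %% 4)%N.
have nE : n = (l + (l + (l + (l + r))))%N by have := divn_eq n 4; rewrite -/l -/r; lia.
have l8 : (8 <= l)%N by rewrite /l leq_divRL //; lia.
have r4 : (r < 4)%N by rewrite ltn_mod.
have cost : (p ^ (l * l) <= 12 * 2 ^ worst_case_cost P * p ^ (1 + 'C(l.+1, 2)))%N.
  clear n_ge l8 r4; move: l r nE => l r nE; subst n.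
  exact: cost_lower_bound sol.
set c := worst_case_cost P in cost *.
have binE : ('C(l.+1, 2) * 2 = l.+1 * l)%N by rewrite mulnC -(mul_bin_diag l.+1 1) bin1.
(* Of the 5, one comes from the exponent in [cost] and four absorb the constant, as 12 <= 2^4 <=
   p^4. *)
pose e := (l * l - (5 + 'C(l.+1, 2)))%N.
have e_le : (5 + 'C(l.+1, 2) <= l * l)%N by nia.
have pe : (p ^ e <= 2 ^ c)%N.
  rewrite -(leq_pmul2r (m := p ^ (5 + 'C(l.+1, 2)))) ?expn_gt0 ?(ltnW p1) // -expnD subnK //.
  apply: leq_trans cost _; rewrite
    (_ : 5 + _ = 4 + (1 + 'C(l.+1, 2)))%N // [(p ^ (4 + _))%N]expnD.
  rewrite [(12 * _)%N]mulnC -mulnA leq_mul2l leq_mul2r; apply/orP; right; apply/orP; right.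
  by apply: (@leq_trans (2 ^ 4)) => //; rewrite leq_exp2r.
have lnp0 : 0 <= ln p%:R :> R by rewrite ln_ge0 // ler1n ltnW.
have lnpe : e%:R * ln p%:R <= c%:R :> R.
  (* The factor [ln 2%:R] is at most 1, by ln(1 + x) <= x at x = 1. *)
  apply: (@le_trans _ _ (c%:R * ln 2%:R)).
    rewrite !mulr_natl -!lnXn ?ltr0n ?(ltnW p1) //.
    by rewrite ler_ln ?posrE ?exprn_gt0 ?ltr0n ?(ltnW p1) // -!natrX ler_nat.
  rewrite -[leRHS]mulr1 ler_wpM2l ?ler0n //.
  by rewrite -[2%:R]/(1 + 1) le_ln1Dx.
apply: le_trans lnpe; rewrite ler_wpM2r // mul1r mulrC ler_pdivrMr // -natrX -natrM ler_nat.
rewrite -mulnn /e; clearbody l r; nia.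
Qed.
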